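(* Let $q$ be a prime power and $A=\mathbb{F}_q[T]$. For $i\ge -1$ define polynomials $U_i(s)\in A[1/T][s]=\mathbb{F}_q[T,1/T][s]$ recursively by $U_{-1}(s)=0$, $U_0(s)=1$ and, for $i\ge 0$, $$U_{i+1}(s)=\Bigl((s^q-s)^{q-1}+\frac{1}{T^{q-1}}\Bigr)^{q^i}U_i(s)-\frac{T^{q^i}-T}{T^{q^{i+1}}}(s^q-s)^{(q-1)q^{i-1}}U_{i-1}(s)$$ (for $i=0$ the second term is understood to be $0$). Let $p(T)\in A$ be an irreducible polynomial of degree $d$ with $\langle p(T)\rangle\neq\langle T\rangle$. Then $$H_{p(T)}(s)=U_d^{(p(T))}(s),$$ where $H_{p(T)}(s)$ is the Deuring polynomial for Drinfeld modules in Legendre form in $A$-characteristic $p(T)$ and $U_d^{(p(T))}(s)$ denotes the reduction of $U_d(s)$ modulo $p(T)$.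
   Context: Let $L$ be an $A$-field, i.e. a field with a ring homomorphism $\gamma:A\to L$ (so $L\supseteq\mathbb{F}_q$, with $\gamma$ $\mathbb{F}_q$-linear), of $A$-characteristic $\ker\gamma=\langle p(T)\rangle$. Let $\overline{L}$ be an algebraic closure of $L$, and let $\tau$ be the $q$-power Frobenius; $\overline{L}\{\tau\}$ is the twisted polynomial ring with $\tau c=c^q\tau$, and $\sum c_k\tau^k$ acts on $\overline{L}$ by $x\mapsto\sum c_kx^{q^k}$. A rank $2$ Drinfeld $A$-module $\psi$ over $\overline{L}$ is an $\mathbb{F}_q$-algebra homomorphism $A\to\overline{L}\{\tau\}$, $a\mapsto\psi_a$, determined by $\psi_T=\Delta\tau^2+g\tau+\gamma(T)$ with $\Delta\ne0$. It is supersingular if $\psi[p(T)]=\{x\in\overline{L}:\psi_{p(T)}(x)=0\}$ is $\{0\}$ (equivalently, the coefficient of $\tau^d$ in $\psi_{p(T)}$ is zero, where $d=\deg p(T)$). For $\lambda\in\overline{L}\setminus\mathbb{F}_q$, the Drinfeld module $\psi^\lambda$ in Legendre form is given by $$\psi^{\lambda}_T=\frac{\gamma(T)}{(\lambda^q-\lambda)^{q-1}}\tau^2-\Bigl(\frac{\gamma(T)}{(\lambda^q-\lambda)^{q-1}}+\gamma(T)\Bigr)\tau+\gamma(T).$$ The Deuring polynomial is $H_{p(T)}(s)=\prod(s-\lambda)$, the product being over all $\lambda\in\overline{L}\setminus\mathbb{F}_q$ such that $\psi^\lambda$ is supersingular. Reduction modulo $p(T)$ of a polynomial over $A[1/T]$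 means applying the map $A[1/T]\to A/\langle p(T)\rangle$ to the coefficients ($T$ is invertible modulo $p(T)$); $A/\langle p(T)\rangle$ is regarded as a subfield of $\overline{L}$ via $\gamma$, and the asserted equality is in $\overline{L}[s]$. *)

(* Defs.v *)
From HB Require Import structures.
From mathcomp Require Import all_boot all_order all_algebra all_field.
From mathcomp Require Import boolp classical_sets cardinality fsbigop.

Set Implicit Arguments.
Unset Strict Implicit.
Unset Printing Implicit Defensive.

Import GRing.Theory.
Local Open Scope classical_set_scope.
Local Open Scope ring_scope.

Local Notation "x %:F" := (@FracField.tofrac _ x).

(* A = {poly F} with T = 'X, and q = #|F|. A[1/T] is realized as the subring
   of Frac(A) consisting of the a / T^n. *)
Section LocalizationAwayFromT.

Variable F : finFieldType.

Definition loc_pred : {pred {fraction {poly F}}} :=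
  fun x => `[< exists (a : {poly F}) (n : nat), x = a%:F / 'X%:F ^+ n >].

Lemma fracX_neq0 n : ('X : {poly F})%:F ^+ n != 0.
Proof. by rewrite expf_neq0 // tofrac_eq0 polyX_eq0. Qed.

Fact loc_subring_closed : subring_closed loc_pred.
Proof.
split.
- by apply/asboolP; exists 1, 0%N; rewrite tofrac1 expr0 divr1.
- move=> x y /asboolP[a [m ->]] /asboolP[b [n ->]]; apply/asboolP.
  exists (a * 'X ^+ n - b * 'X ^+ m), (m + n)%N.
  rewrite tofracB !tofracM !tofracXn exprD.
  rewrite mulrBl invfM; congr (_ - _).
    by rewrite -mulrA (mulrCA _ (_ ^+ m)^-1) divff ?fracX_neq0 // mulr1.
  by rewrite -mulrA [X in _ = _ * X]mulrA divff ?fracX_neq0 // mul1r.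
- move=> x y /asboolP[a [m ->]] /asboolP[b [n ->]]; apply/asboolP.
  by exists (a * b), (m + n)%N; rewrite tofracM exprD invfM mulrACA.
Qed.

HB.instance Definition _ :=
  GRing.isSubringClosed.Build {fraction {poly F}} loc_pred loc_subring_closed.

Record loc : predArgType :=
  Loc { loc_val : {fraction {poly F}}; _ : loc_val \in loc_pred }.

HB.instance Definition _ := [isSub for loc_val].
HB.instance Definition _ := [Choice of loc by <:].
HB.instance Definition _ := [SubChoice_isSubComNzRing of loc by <:].

Fact frac_loc (a : {poly F}) n : a%:F / 'X%:F ^+ n \in loc_pred.
Proof. by apply/asboolP; exists a, n. Qed.

Definition loc_frac (a : {poly F}) (n : nat) : loc := Loc (frac_loc a n).

Fact loc_ex (x : loc) : exists an : {poly F} * nat, x = loc_frac an.1 an.2.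
Proof.
by case: x => x /[dup] /asboolP[a [n e]] Hx; exists (a, n); apply: val_inj.
Qed.

End LocalizationAwayFromT.

Section LegendreU.

Variable F : finFieldType.

Local Notation q := #|F|%N.
Local Notation s := ('X : {poly (loc F)}).

(* legendreU_pair i = (U_{i-1}, U_i). For i = 0 the truncated i.-1 is harmless,
   since U_{-1} = 0. *)
Fixpoint legendreU_pair (i : nat) : {poly (loc F)} * {poly (loc F)} :=
  if i is i'.+1 then
    let: (u, v) := legendreU_pair i' in
    (v, ((s ^+ q - s) ^+ q.-1 + (loc_frac 1 q.-1)%:P) ^+ (q ^ i') * v
        - (loc_frac ('X ^+ (q ^ i') - 'X) (q ^ i'.+1))%:P
          * (s ^+ q - s) ^+ (q.-1 * q ^ i'.-1) * u)
  else (0, 1).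

Definition legendreU (i : nat) : {poly (loc F)} := (legendreU_pair i).2.

End LegendreU.

(* {poly %/ h} is the quotient by h only when h is monic; normalizing p does
   not change the ideal it generates. *)
Definition monicize (F : fieldType) (p : {poly F}) := (lead_coef p)^-1 *: p.

Section Reduction.

Variables (F : finFieldType) (p : {poly F}).

Definition residue := {poly %/ monicize p}.

Definition reduction (x : loc F) : residue :=
  let an := sval (cid (loc_ex x)) in
  in_qpoly (monicize p) an.1 / in_qpoly (monicize p) 'X ^+ an.2.

Lemma residueX_unit : irreducible_poly p -> ~~ (p %= 'X) ->
  in_qpoly (monicize p) 'X \is a GRing.unit.
Proof.
move=> pirr pX.
have p0 : p != 0 by rewrite -size_poly_gt0 (ltn_trans _ pirr.1).
have lc0 : (lead_coef p)^-1 != 0 by rewrite invr_eq0 lead_coef_eq0.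
have mE : mk_monic (monicize p) = monicize p.
  rewrite /mk_monic size_scale // pirr.1 /=.
  by rewrite ifT // monicE lead_coefZ mulVf // lead_coef_eq0.
rewrite unfold_in /= mE.
have mon : monicize p \is monic by rewrite monicE lead_coefZ mulVf ?lead_coef_eq0.
rewrite -Pdiv.IdomainMonic.modpE // coprimep_modr coprimepZl //.
rewrite irreducible_poly_coprime //.
apply: contra pX => pdX.
have szp : size p == 2%N.
  rewrite eqn_leq pirr.1 andbT.
  by have := dvdp_leq _ pdX; rewrite size_polyX polyX_eq0; apply.
by rewrite -dvdp_size_eqp // (eqP szp) size_polyX.
Qed.

Lemma reduction_frac (a : {poly F}) n : irreducible_poly p -> ~~ (p %= 'X) ->
  reduction (loc_frac a n) =
  in_qpoly (monicize p) a / in_qpoly (monicize p) 'X ^+ n.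
Proof.
move=> pirr pX; have uX := residueX_unit pirr pX.
rewrite /reduction; case: cid => b /= /(congr1 val) /= e.
have {}e : a * 'X ^+ b.2 = b.1 * 'X ^+ n.
  apply/eqP; rewrite -tofrac_eq !tofracM !tofracXn.
  by rewrite -eqr_div ?fracX_neq0 // e.
have /(congr1 (in_qpoly (monicize p))) := e; rewrite !rmorphM !rmorphXn /= => e'.
apply: (mulIr (unitrX n uX)); rewrite divrK ?unitrX //.
by rewrite mulrAC -e' mulrK ?unitrX.
Qed.

End Reduction.

(* K{tau}: the polynomial f stands for \sum_k f`_k tau^k, and the product is
   twisted by tau c = c^q tau. The argument gamma fixes F, hence q. *)
Definition twisted (F : finFieldType) (K : fieldType)
  (gamma : {rmorphism {poly F} -> K}) : Type := {poly K}.

(* gamma : A -> K makes K an A-field; F_q is embedded in K through gamma. *)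
Section Drinfeld.

Variables (F : finFieldType) (K : fieldType) (gamma : {rmorphism {poly F} -> K}).

Local Notation q := #|F|%N.

Lemma frobD n (x y : K) : (x + y) ^+ (q ^ n) = x ^+ (q ^ n) + y ^+ (q ^ n).
Proof.
have [r rP rF] := finPcharP F.
rewrite exprDn_pchar // (card_pprimeChar rF) -expnM.
by rewrite pnatX pnatE // (rmorph_pchar (gamma \o polyC)).
Qed.

Lemma frob0 n : (0 : K) ^+ (q ^ n) = 0.
Proof. by rewrite expr0n expn_eq0 -leqn0 leqNgt (ltnW (finNzRing_gt1 F)). Qed.

Lemma frob_sum n I (r : seq I) (P : pred I) (f : I -> K) :
  (\sum_(i <- r | P i) f i) ^+ (q ^ n) = \sum_(i <- r | P i) f i ^+ (q ^ n).
Proof. by apply: (big_morph (fun x : K => x ^+ (q ^ n)) (frobD n) (frob0 n)). Qed.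

Local Notation Ktau := (twisted gamma).

HB.instance Definition _ := GRing.Zmodule.copy Ktau {poly K}.

Definition tmul (f g : Ktau) : Ktau :=
  \poly_(k < (size f + size g).-1)
     \sum_(i < k.+1) f`_i * g`_(k - i) ^+ (q ^ i).

Lemma coef_tmul (f g : Ktau) k :
  (tmul f g)`_k = \sum_(i < k.+1) f`_i * g`_(k - i) ^+ (q ^ i).
Proof.
rewrite coef_poly ltn_predRL; case: leqP => // le_fg_k1.
rewrite big1 // => j _; have [lf_j|lt_j_f] := leqP (size f) j.
  by rewrite nth_default ?mul0r.
rewrite [g`__]nth_default ?frob0 ?mulr0 // leq_subRL -ltnS //.
by rewrite (leq_trans _ le_fg_k1) // ltn_add2r.
Qed.

Fact tmulA : associative tmul.
Proof.
move=> p r t; apply/polyP=> i; rewrite !coef_tmul.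
pose coef3 j k :=
  p`_j * (r`_(k - j) ^+ (q ^ j) * t`_(i - k) ^+ (q ^ k)).
transitivity (\sum_(j < i.+1) \sum_(k < i.+1 | (j <= k)%N) coef3 j k).
  apply: eq_bigr => -[j /= ji] _; rewrite coef_tmul frob_sum big_distrr /=.
  rewrite -(big_geq_mkord j i.+1 xpredT (coef3 j)).
  have -> : \sum_(j <= k < i.+1) coef3 j k =
            \sum_(0 + j <= k < i.+1) coef3 j k by rewrite add0n.
  rewrite big_addn.
  rewrite big_mkord subSn //; apply: eq_bigr => l _.
  rewrite /coef3 addnK exprMn -exprM -expnD [(i - (l + j))%N]subnDA.
  by rewrite -!subnDA [(l + j)%N]addnC.
rewrite (exchange_big_dep predT) //=; apply: eq_bigr => k _.
rewrite coef_tmul big_distrl /= (big_ord_narrow_leq (leq_ord k)) /=.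
by apply: eq_bigr => j _; rewrite /coef3 /= mulrA.
Qed.

Fact tmul1l : left_id (1%:P : Ktau) tmul.
Proof.
move=> f; apply/polyP => i; rewrite coef_tmul big_ord_recl subn0 big1.
  by rewrite coefC expn0 expr1 mul1r addr0.
by move=> j _; rewrite coefC mul0r.
Qed.

Fact tmul1r : right_id (1%:P : Ktau) tmul.
Proof.
move=> f; apply/polyP => i; rewrite coef_tmul big_ord_recr /= subnn big1.
  by rewrite coefC expr1n mulr1 add0r.
by move=> j _; rewrite coefC subn_eq0 leqNgt ltn_ord /= frob0 mulr0.
Qed.

Fact tmulDl : left_distributive tmul +%R.
Proof.
move=> f g h; apply/polyP=> i; rewrite coefD !coef_tmul -big_split.
by apply: eq_bigr => j _; rewrite coefD mulrDl.
Qed.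

Fact tmulDr : right_distributive tmul +%R.
Proof.
move=> f g h; apply/polyP=> i; rewrite coefD !coef_tmul -big_split.
by apply: eq_bigr => j _; rewrite coefD frobD mulrDr.
Qed.

Fact twisted1_neq0 : (1%:P : Ktau) != 0.
Proof. by rewrite polyC_eq0 oner_neq0. Qed.

HB.instance Definition _ := GRing.Zmodule_isNzRing.Build Ktau
  tmulA tmul1l tmul1r tmulDl tmulDr twisted1_neq0.

Definition tau : Ktau := 'X.
Definition tconst (c : K) : Ktau := c%:P.

Fact tconst_zmod_morphism : zmod_morphism tconst.
Proof. by move=> a b; rewrite /tconst polyCB. Qed.

Fact tconst_monoid_morphism : monoid_morphism tconst.
Proof.
split=> // a b; apply/polyP => i; rewrite coef_tmul big_ord_recl subn0 big1.
  by rewrite !coefC expn0 expr1 addr0; case: i => [|i] //=; rewrite mulr0.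
by move=> j _; rewrite coefC mul0r.
Qed.

HB.instance Definition _ :=
  GRing.isZmodMorphism.Build K Ktau tconst tconst_zmod_morphism.
HB.instance Definition _ :=
  GRing.isMonoidMorphism.Build K Ktau tconst tconst_monoid_morphism.

Lemma coef_tconstM c (f : Ktau) i : (tconst c * f : Ktau)`_i = c * f`_i.
Proof.
rewrite coef_tmul big_ord_recl subn0 big1.
  by rewrite coefC expn0 expr1 addr0.
by move=> j _; rewrite coefC mul0r.
Qed.

Lemma coef_tauM (f : Ktau) i :
  (tau * f : Ktau)`_i = if i is i'.+1 then f`_i' ^+ q else 0.
Proof.
rewrite coef_tmul; case: i => [|i].
  by rewrite big_ord1 coefX mul0r.
rewrite !big_ord_recl big1 => [|j _]; last by rewrite coefX mul0r.
by rewrite !coefX mul0r mul1r add0r addr0 /= expn1 subn1.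
Qed.

Lemma tau_tconst (c : K) : tau * tconst c = tconst (c ^+ q) * tau.
Proof.
apply/polyP => i; rewrite coef_tauM coef_tconstM.
case: i => [|i]; rewrite ?coefX ?mulr0 // coefC /=.
by case: i => [|i]; rewrite ?mulr1 ?mulr0 // -(expn1 q) frob0.
Qed.

(* f = \sum_k f`_k tau^k acts on K by x |-> \sum_k f`_k x^(q^k). *)
Definition tact (f : Ktau) (x : K) : K :=
  \sum_(k < size f) f`_k * x ^+ (q ^ k).

Definition drinfeldT (Delta g : K) : Ktau :=
  tconst Delta * tau ^+ 2 + tconst g * tau + tconst (gamma 'X).

Definition tscalar : {rmorphism F -> Ktau} := tconst \o gamma \o polyC.

Fact drinfeld_comm (Delta g : K) : commr_rmorph tscalar (drinfeldT Delta g).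
Proof.
move=> c; have comC b : GRing.comm (tconst b) (tscalar c).
  by rewrite /GRing.comm /= -!rmorphM mulrC.
have comT : GRing.comm tau (tscalar c).
  by rewrite /GRing.comm tau_tconst /= -!rmorphXn /= expf_card.
apply: GRing.Theory.commr_sym.
by do ![apply: commrD | apply: commrM | apply: commrX]; apply: commr_sym.
Qed.

(* The F_q-algebra morphism psi : A -> K{tau} with psi_T = drinfeldT Delta g,
   where K{tau} is an F_q-algebra through tscalar. It is a Drinfeld module of
   rank 2 when Delta != 0. *)
Definition drinfeld (Delta g : K) : {rmorphism {poly F} -> Ktau} :=
  horner_morph (drinfeld_comm Delta g).

Definition torsion (psi : {poly F} -> Ktau) (a : {poly F}) : set K :=
  [set x | tact (psi a) x = 0].

Definition supersingular (p : {poly F}) (psi : {poly F} -> Ktau) : Prop :=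
  torsion psi p = [set 0].

Definition inFq (x : K) : Prop := exists c : F, x = gamma c%:P.

Definition legendreDelta (lambda : K) : K :=
  gamma 'X / (lambda ^+ q - lambda) ^+ q.-1.

Definition legendre (lambda : K) : {rmorphism {poly F} -> Ktau} :=
  drinfeld (legendreDelta lambda) (- (legendreDelta lambda + gamma 'X)).

Lemma legendreDelta_neq0 (lambda : K) :
  gamma 'X != 0 -> ~ inFq lambda -> legendreDelta lambda != 0.
Proof.
move=> gX nFq; rewrite mulf_neq0 // invr_neq0 // expf_neq0 //.
apply/eqP => l0; apply: nFq.
have /(congr1 (fun f => (map_poly (gamma \o polyC) f).[lambda])) :=
  finField_genPoly F.
rewrite rmorphB rmorph_prod /= map_polyXn map_polyX !hornerE l0 horner_prod.
move=> /esym/eqP/prodf_eq0[c _ /eqP].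
rewrite rmorphB /= map_polyX map_polyC !hornerE /= => /eqP.
by rewrite subr_eq0 => /eqP->; exists c.
Qed.

Definition supersingular_locus (p : {poly F}) : set K :=
  [set lambda | ~ inFq lambda /\ supersingular p (legendre lambda)].

(* The finitely supported product over an infinite set is 1 by convention;
   no factor is 1, so this is the true product once the locus is finite. *)
Definition deuring (p : {poly F}) : {poly K} :=
  \big[*%R/1]_(lambda \in supersingular_locus p) ('X - lambda%:P).

(* A/<p> -> K, well defined when gamma kills p. *)
Definition residue_embed (p : {poly F}) (x : residue p) : K :=
  gamma (x : {poly F}).

End Drinfeld.

(* Main.v *)
From HB Require Import structures.
Require Import Defs.
From mathcomp Require Import all_boot all_order all_algebra all_field.
From mathcomp Require Import boolp classical_sets cardinality fsbigop.
From mathcomp Require Import ring.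

(** Write t = gamma(T), w = (lambda^q - lambda)^(q-1), Delta = t / w, and let psi
    be the Legendre form at lambda, so that
    psi_T = Delta tau^2 - (Delta + t) tau + t.

    Supersingularity is the vanishing of one coefficient. As psi_p commutes with
    psi_T, its lowest term tau^m satisfies t^(q^m) = t, so that d divides m
    ([frob_T_neq], [commute_low_coef]). Hence psi_p starts in degree d or 2d, and
    2d is its degree; over an algebraically closed field it has a nonzero root
    unless it is a monomial. So psi is supersingular if and only if the
    coefficient of tau^d in psi_p is zero ([supersingularP]).

    That coefficient satisfies a recursion. Let X act on K{tau} by right
    multiplication by the image of T, commuting with left multiplication by K.
    Then psi_p is p(X) applied to 1, and p splits over K into the factors
    X - t^(q^i). Applying these factors one by one gives Gekeler's recursion for
    the Hasse invariant ([coef_twist_prod], [coef_p_hasse]).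

    The recursion obtained for psi is not the one that defines the U_i. Rather,
    psi_T = (Delta tau - t)(tau - 1), so tau - 1 is an isogeny from psi to the
    module phi with phi_T = (tau - 1)(Delta tau - t), and the coefficients of
    tau^d in psi_p and phi_p are equal ([isogeny_coef]). The Hasse invariant of
    phi satisfies, up to an explicit nonzero factor, the recursion of the U_i
    ([hasse_legendre]). Therefore the supersingular lambda outside F_q are the
    roots of U_d outside F_q.

    It remains to see that U_d is the product of the linear factors at these
    lambda. It is monic, it has no root in F_q, and its roots are simple: the
    Wronskian U_d' U_(d-1) - U_d U_(d-1)' is a product of powers of s^q - s and
    of constants that contain t^(q^i) - t with 0 < i < d, so it vanishes only on
    F_q ([legendre_rec_simple_roots]). *)

Set Implicit Arguments.
Unset Strict Implicit.
Unset Printing Implicit Defensive.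

Import GRing.Theory.
Local Open Scope ring_scope.

(** * Powers of Frobenius on an A-field *)

Section Frobenius.

Variables (F : finFieldType) (K : fieldType) (gamma : {rmorphism {poly F} -> K}).

Local Notation q := #|F|%N.

Lemma cardF_gt1 : (1 < q)%N.
Proof. exact: finNzRing_gt1. Qed.

Lemma card_expn_gt0 k : (0 < q ^ k)%N.
Proof. by rewrite expn_gt0 (ltnW cardF_gt1). Qed.

Lemma frobN k (x : K) : (- x) ^+ (q ^ k) = - x ^+ (q ^ k).
Proof.
by apply/eqP; rewrite -addr_eq0 -(frobD gamma) addNr frob0.
Qed.

Lemma frobB k (x y : K) : (x - y) ^+ (q ^ k) = x ^+ (q ^ k) - y ^+ (q ^ k).
Proof. by rewrite (frobD gamma) frobN. Qed.

Lemma frob_comp i j (x : K) : x ^+ (q ^ i) ^+ (q ^ j) = x ^+ (q ^ (i + j)).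
Proof. by rewrite -exprM -expnD. Qed.

Lemma frob_inj k (x y : K) : x ^+ (q ^ k) = y ^+ (q ^ k) -> x = y.
Proof.
move=> /eqP; rewrite -subr_eq0 -frobB expf_eq0 card_expn_gt0 subr_eq0 /=.
by move/eqP.
Qed.

Lemma frob_gammaC k (c : F) : gamma c%:P ^+ (q ^ k) = gamma c%:P.
Proof.
elim: k => [|k IH]; first by rewrite expn0 expr1.
by rewrite expnSr exprM IH -!rmorphXn /= expf_card.
Qed.

Lemma card_natr0 : q%:R = 0 :> K.
Proof.
rewrite -(rmorph_nat (gamma \o polyC)).
suff -> : q%:R = 0 :> F by rewrite rmorph0.
have [r rP rF] := finPcharP F.
have [n ->] : exists n, q = (r * n)%N.
  have /dvdnP[n ->]: (r %| q)%N.
    have := cardF_gt1; rewrite (card_pprimeChar rF).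
    by move: (X in (r ^ X)%N) => n n1; rewrite dvdn_exp //; case: n n1.
  by exists n; rewrite mulnC.
by rewrite natrM (pcharf0 rF) mul0r.
Qed.

Lemma gamma_frob_fixed k (a : {poly F}) :
  gamma 'X ^+ (q ^ k) = gamma 'X -> gamma a ^+ (q ^ k) = gamma a.
Proof.
move=> fixT; elim/poly_ind: a => [|a c IH]; first by rewrite rmorph0 frob0.
by rewrite rmorphD rmorphM (frobD gamma) exprMn IH fixT frob_gammaC.
Qed.

End Frobenius.

(** * The recursion for the polynomials U_i *)

Section LegendreRecursion.

Variable F : finFieldType.
Local Notation q := #|F|%N.
Local Notation s := ('X : {poly loc F}).
Local Notation w := ((s ^+ q - s) ^+ q.-1).

Lemma legendreU_pairS i :
  legendreU_pair F i.+1 =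
  let: (u, v) := legendreU_pair F i in
  (v, (w + (loc_frac 1 q.-1)%:P) ^+ (q ^ i) * v
      - (loc_frac ('X ^+ (q ^ i) - 'X) (q ^ i.+1))%:P
        * (s ^+ q - s) ^+ (q.-1 * q ^ i.-1) * u).
Proof. reflexivity. Qed.

Lemma legendreU1 : legendreU F 1 = w + (loc_frac 1 q.-1)%:P.
Proof.
have init (R : pzRingType) (x y : R) : x ^+ (q ^ 0) * 1 - y * 0 = x.
  by rewrite expn0 expr1 mulr0 subr0 mulr1.
by rewrite {1}/legendreU legendreU_pairS; exact: init.
Qed.

Lemma legendreUS i :
  legendreU F i.+2 = (w + (loc_frac 1 q.-1)%:P) ^+ (q ^ i.+1) * legendreU F i.+1
    - (loc_frac ('X ^+ (q ^ i.+1) - 'X) (q ^ i.+2))%:P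
      * (s ^+ q - s) ^+ (q.-1 * q ^ i) * legendreU F i.
Proof.
have pairE : legendreU_pair F i.+1 = (legendreU F i, legendreU F i.+1).
  by rewrite /legendreU legendreU_pairS; case: (legendreU_pair F i).
by rewrite {1}/legendreU legendreU_pairS pairE.
Qed.

Lemma rmorph_legendre_step (A B : comNzRingType) (f : {rmorphism A -> B})
    (z x y u v : A) k m n :
  f (((z ^+ q - z) ^+ k + x) ^+ m * u - y * (z ^+ q - z) ^+ n * v) =
  ((f z ^+ q - f z) ^+ k + f x) ^+ m * f u - f y * (f z ^+ q - f z) ^+ n * f v.
Proof. by rewrite rmorphB !rmorphM !rmorphXn rmorphD !rmorphXn rmorphB rmorphXn. Qed.

End LegendreRecursion.

(** * The residue field at p and the conjugates of T *)

Section Residue.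

Variables (F : finFieldType) (K : fieldType) (gamma : {rmorphism {poly F} -> K}).
Variable p : {poly F}.
Hypothesis p_irr : irreducible_poly p.
Hypothesis ker_gamma : forall a : {poly F}, gamma a = 0 <-> p %| a.

Local Notation q := #|F|%N.
Local Notation d := (size p).-1.
Local Notation t := (gamma 'X).

Lemma irr_neq0 : p != 0.
Proof. by rewrite -size_poly_gt0 (ltn_trans _ p_irr.1). Qed.

Lemma monicize_irr : monic_irreducible_poly (monicize p).
Proof.
have lc0 : (lead_coef p)^-1 != 0 by rewrite invr_eq0 lead_coef_eq0 irr_neq0.
split; last by rewrite monicE lead_coefZ mulVf // lead_coef_eq0 irr_neq0.
split; first by rewrite size_scale // p_irr.1.
move=> r r1; rewrite dvdpZr // => /(p_irr.2 _ r1) e.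
by rewrite (eqp_trans e) // eqp_sym eqp_scale.
Qed.

Lemma residue_embed_in (a : {poly F}) :
  residue_embed gamma (in_qpoly (monicize p) a) = gamma a.
Proof.
rewrite /residue_embed /= (mk_monicE monicize_irr).
rewrite -Pdiv.IdomainMonic.modpE ?monicize_irr.2 //.
rewrite [in RHS](divp_eq a (monicize p)) rmorphD rmorphM /=.
have -> : gamma (monicize p) = 0.
  by apply/ker_gamma; rewrite dvdpZr ?dvdpp // invr_eq0 lead_coef_eq0 irr_neq0.
by rewrite mulr0 add0r.
Qed.

Lemma residue_in_qpoly (x : residue p) :
  x = in_qpoly (monicize p) (x : {poly F}).
Proof. by apply: val_inj; rewrite [RHS]in_qpoly_small // size_mk_monic. Qed.

Lemma residue_embed_zmod : zmod_morphism (residue_embed gamma (p := p)).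
Proof. by move=> x y; rewrite /residue_embed -rmorphB. Qed.

Lemma residue_embed_monoid : monoid_morphism (residue_embed gamma (p := p)).
Proof.
split=> [|x y]; first by rewrite -in_qpoly1 residue_embed_in rmorph1.
rewrite (residue_in_qpoly x) (residue_in_qpoly y) -in_qpolyM.
by rewrite !residue_embed_in rmorphM.
Qed.

HB.instance Definition _ := GRing.isZmodMorphism.Build (residue p) K
  (residue_embed gamma (p := p)) residue_embed_zmod.
HB.instance Definition _ := GRing.isMonoidMorphism.Build (residue p) K
  (residue_embed gamma (p := p)) residue_embed_monoid.

Let resF := {poly %/ monicize p with monicize_irr}.

(** Together with [expf_card] this gives the whole Frobenius orbit of T:
    the residue field has q^d elements, so t^(q^d) = t, and no smaller power of
    Frobenius fixes t, since it would then fix q^d elements. *)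
Lemma card_residue : #|{: resF}| = (q ^ d)%N.
Proof.
by rewrite card_qfpoly size_scale // invr_eq0 lead_coef_eq0 irr_neq0.
Qed.

Lemma frob_T_deg : t ^+ (q ^ d) = t.
Proof.
rewrite -residue_embed_in -rmorphXn; congr (residue_embed gamma _).
by rewrite -card_residue; exact: (@expf_card resF).
Qed.

Lemma frob_T_neq i : (0 < i < d)%N -> t ^+ (q ^ i) != t.
Proof.
move=> /andP[i0 ltid]; apply/eqP => fixT.
have fixR (x : resF) : x ^+ (q ^ i) = x.
  apply: (fmorph_inj (residue_embed gamma (p := p) : {rmorphism resF -> K})).
  rewrite rmorphXn /=; rewrite (residue_in_qpoly x) residue_embed_in.
  exact: gamma_frob_fixed.
have szP : size ('X^(q ^ i) - 'X : {poly resF}) = (q ^ i).+1.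
  rewrite size_polyDl size_polyXn // size_polyN size_polyX ltnS.
  by rewrite (leq_trans (cardF_gt1 F)) // -{1}(expn1 q) leq_exp2l ?cardF_gt1.
(* All q^d elements of the residue field would be roots of a polynomial
     of degree q^i < q^d. *)
have := @max_poly_roots _ ('X^(q ^ i) - 'X) (enum {: resF}).
rewrite szP -cardE card_residue ltnS leqNgt ltn_exp2l ?cardF_gt1 // ltid /=.
move=> H; suff: false by []; apply: H; last exact: enum_uniq.
  by rewrite -size_poly_eq0 szP.
by apply/allP => x _; rewrite rootE !hornerE fixR subrr.
Qed.

Lemma frob_horner i (a : {poly F}) :
  (map_poly (gamma \o polyC) a).[t ^+ (q ^ i)] = gamma a ^+ (q ^ i).
Proof.
elim/poly_ind: a => [|a c IH]; first by rewrite !rmorph0 horner0 frob0.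
rewrite !rmorphD !rmorphM /= map_polyX map_polyC !hornerE /= IH.
by rewrite (frobD gamma) exprMn frob_gammaC.
Qed.

(** Each conjugate of t is a root of p, and there are d of them. The exponents
    run over 1, ..., d instead of 0, ..., d-1, which is the same set of conjugates
    because t^(q^d) = t; this is the form that matches the recursion for the
    coefficients of psi_p in [coef_twist_prod]. *)
Lemma gamma_p_factor :
  map_poly (gamma \o polyC) p =
  gamma (lead_coef p)%:P *: \prod_(i < d) ('X - (t ^+ (q ^ i.+1))%:P).
Proof.
pose rs := [seq t ^+ (q ^ i.+1) | i <- iota 0 d].
have := @all_roots_prod_XsubC K (map_poly (gamma \o polyC) p) rs.
rewrite size_map_poly lead_coef_map size_map size_iota big_map /=.
have -> : \prod_(i <- iota 0 d) ('X - (t ^+ (q ^ i.+1))%:P) =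
          \prod_(i < d) ('X - (t ^+ (q ^ i.+1))%:P).
  rewrite -(big_mkord xpredT (fun i => 'X - (t ^+ (q ^ i.+1))%:P)).
  by rewrite /index_iota subn0.
apply.
- by rewrite prednK // size_poly_gt0 irr_neq0.
- apply/allP => _ /mapP[i _ ->]; rewrite rootE frob_horner.
  by have /ker_gamma -> := dvdpp p; rewrite frob0.
rewrite uniq_rootsE map_inj_in_uniq ?iota_uniq // => i j.
rewrite !mem_iota !add0n !leq0n /=.
wlog le_ij : i j / (i <= j)%N => [H id jd e|].
  by case: (leqP i j) => [/H|/ltnW/H] h; [apply: h | rewrite -h].
move=> ltid ltjd e; apply/eqP; rewrite eqn_leq le_ij leqNgt; apply/negP => lt_ij.
have /frob_T_neq/eqP[] : (0 < j - i < d)%N.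
  by rewrite subn_gt0 lt_ij (leq_ltn_trans (leq_subr _ _)).
apply: (@frob_inj _ _ gamma i.+1); rewrite frob_comp [RHS]e.
by rewrite addnS subnK.
Qed.

Hypothesis p_neT : ~~ (p %= 'X).

Lemma gammaX_neq0 : t != 0.
Proof.
apply/eqP => /ker_gamma pdX; case/negP: p_neT.
have szp : size p = 2%N.
  apply/eqP; rewrite eqn_leq p_irr.1 andbT.
  by have := dvdp_leq _ pdX; rewrite size_polyX polyX_eq0; apply.
by rewrite -dvdp_size_eqp // szp size_polyX.
Qed.

(** The composite of reduction modulo p with the embedding of the residue field
    is the evaluation T |-> t on A[1/T]; being a ring morphism, it carries the
    recursion of the U_i to K. *)
Definition loc_eval : loc F -> K := residue_embed gamma (p := p) \o reduction p.

Lemma loc_eval_frac a n : loc_eval (loc_frac a n) = gamma a / t ^+ n.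
Proof.
rewrite /loc_eval /= reduction_frac // rmorphM rmorphV ?unitrX ?residueX_unit //.
by rewrite rmorphXn /= !residue_embed_in.
Qed.

Lemma loc_evalB : zmod_morphism loc_eval.
Proof.
have tn n : t ^+ n != 0 by rewrite expf_neq0 // gammaX_neq0.
move=> x y; have [[a m] ->] := loc_ex x; have [[b n] ->] := loc_ex y.
have -> : loc_frac a m - loc_frac b n =
          loc_frac (a * 'X^n - b * 'X^m) (m + n).
  apply: val_inj => /=; rewrite tofracB !tofracM !tofracXn exprD mulrBl.
  congr (_ - _); apply/eqP.
    by rewrite eqr_div ?mulf_neq0 ?fracX_neq0 // -mulrA [X in _ * X]mulrC.
  by rewrite eqr_div ?mulf_neq0 ?fracX_neq0 // -mulrA.
rewrite !loc_eval_frac rmorphB !rmorphM !rmorphXn exprD /= mulrBl.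
congr (_ - _); apply/eqP.
  by rewrite eqr_div ?mulf_neq0 // -mulrA [X in _ * X]mulrC.
by rewrite eqr_div ?mulf_neq0 // -mulrA.
Qed.

Lemma loc_evalM : monoid_morphism loc_eval.
Proof.
split=> [|x y].
  have -> : (1 : loc F) = loc_frac 1 0.
    by apply: val_inj; rewrite /= tofrac1 expr0 divr1.
  by rewrite loc_eval_frac rmorph1 expr0 divr1.
have [[a m] ->] := loc_ex x; have [[b n] ->] := loc_ex y.
have -> : loc_frac a m * loc_frac b n = loc_frac (a * b) (m + n).
  by apply: val_inj; rewrite /= tofracM exprD invfM mulrACA.
by rewrite !loc_eval_frac rmorphM exprD invfM mulrACA.
Qed.

HB.instance Definition _ := GRing.isZmodMorphism.Build (loc F) K loc_eval loc_evalB.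
HB.instance Definition _ := GRing.isMonoidMorphism.Build (loc F) K loc_eval loc_evalM.

Local Notation s := ('X : {poly K}).

Definition legendreU_mod i : {poly K} :=
  map_poly (residue_embed gamma (p := p)) (map_poly (reduction p) (legendreU F i)).

Lemma legendreU_modE i : legendreU_mod i = map_poly loc_eval (legendreU F i).
Proof. by rewrite /legendreU_mod -map_poly_comp. Qed.

Lemma legendreU_mod0 : legendreU_mod 0 = 1.
Proof. by rewrite legendreU_modE rmorph1. Qed.

Lemma loc_eval1 n : loc_eval (loc_frac 1 n) = (t ^+ n)^-1.
Proof. by rewrite loc_eval_frac rmorph1 div1r. Qed.

Lemma legendreU_mod1 :
  legendreU_mod 1 = (s ^+ q - s) ^+ q.-1 + ((t ^+ q.-1)^-1)%:P.
Proof.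
rewrite legendreU_modE legendreU1 rmorphD rmorphXn rmorphB rmorphXn /=.
by rewrite map_polyX map_polyC /= loc_eval1.
Qed.

Lemma legendreU_modS i :
  legendreU_mod i.+2 =
  ((s ^+ q - s) ^+ q.-1 + ((t ^+ q.-1)^-1)%:P) ^+ (q ^ i.+1) * legendreU_mod i.+1
  - ((t ^+ (q ^ i.+1) - t) / t ^+ (q ^ i.+2))%:P
    * (s ^+ q - s) ^+ q.-1 ^+ (q ^ i) * legendreU_mod i.
Proof.
have evC (x : loc F) : map_poly loc_eval x%:P = (loc_eval x)%:P.
  exact: map_polyC.
rewrite !legendreU_modE legendreUS -exprM.
rewrite (rmorph_legendre_step F
  (map_poly loc_eval : {rmorphism {poly loc F} -> {poly K}})).
have -> : ((t ^+ (q ^ i.+1) - t) / t ^+ (q ^ i.+2))%:P =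
  map_poly loc_eval (loc_frac ('X ^+ (q ^ i.+1) - 'X) (q ^ i.+2))%:P.
  by rewrite evC loc_eval_frac rmorphB [gamma ('X ^+ _)]rmorphXn.
have -> : ((t ^+ q.-1)^-1)%:P = map_poly loc_eval (loc_frac 1 q.-1)%:P.
  by rewrite evC loc_eval1.
have <- : map_poly loc_eval 'X = 'X by exact: map_polyX.
by [].
Qed.

End Residue.

(** * Monic and separable solutions of the recursion *)

Section LegendreRecurrence.

Variables (F : finFieldType) (K : fieldType) (gamma : {rmorphism {poly F} -> K}).
Local Notation q := #|F|%N.

Variable t : K.
Hypothesis t_neq0 : t != 0.

Local Notation w := (('X ^+ q - 'X) ^+ q.-1 : {poly K}).
Local Notation c := ((t ^+ q.-1)^-1).
Local Notation b k := ((t ^+ (q ^ k) - t) / t ^+ (q ^ k.+1)).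

Variable u : nat -> {poly K}.
Hypothesis u0 : u 0 = 1.
Hypothesis u1 : u 1 = w + c%:P.
Hypothesis uS : forall i,
  u i.+2 = (w + c%:P) ^+ (q ^ i.+1) * u i.+1 - (b i.+1)%:P * w ^+ (q ^ i) * u i.

Lemma w_monic : w \is monic.
Proof.
apply: monic_exp; rewrite monicE lead_coefDl ?lead_coefXn //.
rewrite size_polyN size_polyX size_polyXn ltnS; exact: cardF_gt1.
Qed.

Lemma size_w : (1 < size w)%N.
Proof.
have q1 := cardF_gt1 F.
have szq : size ('X ^+ q - 'X : {poly K}) = q.+1.
  by rewrite size_polyDl ?size_polyXn // size_polyN size_polyX.
by rewrite -ltn_predRL size_exp szq muln_gt0 (ltnW q1) ltn_predRL.
Qed.

Lemma size_wD : size (w + c%:P) = size w.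
Proof. by rewrite size_polyDl // (leq_ltn_trans (size_polyC_leq1 _)) ?size_w. Qed.

Lemma wD_monic : w + c%:P \is monic.
Proof.
rewrite monicE lead_coefDl ?(monicP w_monic) //.
by rewrite (leq_ltn_trans (size_polyC_leq1 _)) ?size_w.
Qed.

Lemma wX_monic k : w ^+ k \is monic.
Proof. by apply: monic_exp; exact: w_monic. Qed.

Lemma wDX_monic k : (w + c%:P) ^+ k \is monic.
Proof. by apply: monic_exp; exact: wD_monic. Qed.

Lemma size_wX k : size ((w + c%:P) ^+ k) = size (w ^+ k).
Proof.
apply: succn_inj; rewrite -[in LHS](prednK (n := size _)); last first.
  by rewrite size_poly_gt0 monic_neq0 // wDX_monic.
rewrite -[in RHS](prednK (n := size _)); last first.
  by rewrite size_poly_gt0 monic_neq0 // wX_monic.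
by rewrite size_exp size_wD -size_exp.
Qed.

(** The second term of the recursion has smaller degree than the first. The
    bound on sizes is the invariant that makes the induction go through. *)
Lemma legendre_rec_monic_size i :
  [/\ u i \is monic, u i.+1 \is monic
    & (size (w ^+ (q ^ i) * u i)%R <= size (u i.+1))%N].
Proof.
elim: i => [|i [mi mi1 szi]].
  rewrite u0 u1 mulr1 expn0 expr1 size_wD leqnn; split=> //.
    exact: monic1.
  exact: wD_monic.
pose A := (w + c%:P) ^+ (q ^ i.+1) * u i.+1.
have mA : A \is monic by rewrite monicMl // wDX_monic.
have sA : size A = size (w ^+ (q ^ i.+1) * u i.+1).
  rewrite /A size_monicM ?wDX_monic ?monic_neq0 // size_wX.
  by rewrite size_monicM ?wX_monic ?monic_neq0.
have szw : (1 < size (w ^+ (q ^ i.+1))%R)%N.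
  by rewrite -ltn_predRL size_exp muln_gt0 card_expn_gt0 andbT ltn_predRL size_w.
have sB : (size (- ((b i.+1)%:P * w ^+ (q ^ i) * u i))%R < size A)%N.
  rewrite size_polyN -mulrA mul_polyC (leq_ltn_trans (size_scale_leq _ _)) //.
  rewrite (leq_ltn_trans szi) // sA size_monicM ?wX_monic ?monic_neq0 //.
  case: (size (w ^+ _)) szw => [|[|n]] //= _.
  by rewrite addSn ltnS leq_addl.
split=> //; rewrite uS -/A; last by rewrite size_polyDl // sA.
by rewrite monicE lead_coefDl // (monicP mA).
Qed.

Lemma legendre_rec_monic i : u i \is monic.
Proof. by have [] := legendre_rec_monic_size i. Qed.

(** At a point of F_q one has w = 0, so only the power of the constant c
    survives in each step. *)
Lemma legendre_rec_Fq_neq0 i (x : K) : x ^+ q = x -> (u i).[x] != 0.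
Proof.
move=> fx; have wx : w.[x] = 0.
  rewrite !hornerE fx subrr expr0n; have := cardF_gt1 F.
  by case: (q) => [|[]].
have cn : c != 0 by rewrite invr_eq0 expf_neq0.
elim: i => [|[|i] IH]; first by rewrite u0 hornerC oner_neq0.
  by rewrite u1 hornerD wx add0r hornerC.
have wqx : (w ^+ (q ^ i)).[x] = 0 by rewrite horner_exp wx frob0.
have wcx : (w + c%:P).[x] = c by rewrite hornerD wx add0r hornerC.
rewrite uS hornerD hornerN !hornerM wqx mulr0 mul0r subr0 horner_exp wcx.
by rewrite mulf_neq0 // expf_neq0.
Qed.

Lemma polyrMn_cardF (h : {poly K}) : h *+ q = 0.
Proof. by rewrite -mulr_natr -polyC_natr (card_natr0 gamma) polyC0 mulr0. Qed.

Lemma deriv_frob (h : {poly K}) k : (h ^+ (q ^ k.+1))^`() = 0.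
Proof. by rewrite deriv_exp expnS mulrnA polyrMn_cardF mul0rn. Qed.

(** From index 1 on, every coefficient of the recursion is a q-th power and
    has derivative 0, so the derivatives satisfy the same recursion as the
    polynomials. Hence the Wronskian is multiplied by an explicit factor at each
    step, and a common root of u_(i+1) and its derivative would be one of its
    roots. *)
Definition wronskian i := (u i.+1)^`() * u i - u i.+1 * (u i)^`().

Lemma wronskian0 : wronskian 0 = w^`().
Proof. by rewrite /wronskian u0 u1 derivC mulr0 subr0 mulr1 derivD derivC addr0. Qed.

Lemma wronskian1 : wronskian 1 = (- (b 1 * c))%:P * w^`().
Proof.
rewrite /wronskian uS u0 mulr1 expn0 expr1 derivB derivM deriv_frob mul0r add0r.
rewrite derivM derivC mul0r add0r u1 derivD derivC addr0.
have -> : (- (b 1 * c))%:P = - ((b 1)%:P * c%:P) :> {poly K}.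
  by rewrite polyCN polyCM.
by move: (b 1)%:P c%:P w (w^`()) => /= B C W W'; ring.
Qed.

Lemma wronskianS i :
  wronskian i.+2 = (b i.+2)%:P * w ^+ (q ^ i.+1) * wronskian i.+1.
Proof.
rewrite /wronskian (uS i.+1) derivB derivM deriv_frob mul0r add0r.
rewrite -mulrA derivM derivC mul0r add0r derivM deriv_frob mul0r add0r.
by move: (b _)%:P (_ ^+ _) (w ^+ _) => /= B A W; ring.
Qed.

(** Its roots are in F_q, like those of w: this is why the Wronskians vanish
    only at points of F_q. *)
Lemma deriv_w : w^`() = ('X ^+ q - 'X) ^+ q.-2.
Proof.
have qK : ((q.-1)%:R : {poly K}) = -1.
  apply/eqP; rewrite -addr_eq0 natr1 prednK ?(ltnW (cardF_gt1 F)) //.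
  by rewrite polyrMn_cardF.
rewrite deriv_exp derivB derivXn derivX polyrMn_cardF sub0r.
by rewrite -mulr_natr qK mulN1r mulrN1 opprK.
Qed.

Lemma legendre_rec_simple_roots d (x : K) :
  (forall i, (0 < i < d)%N -> t ^+ (q ^ i) != t) ->
  root (u d) x -> (u d)^`().[x] != 0.
Proof.
case: d => [|d] tn; first by rewrite u0 rootE hornerC oner_eq0.
move=> rx; have nfx : x ^+ q - x != 0.
  rewrite subr_eq0; apply/eqP => /(legendre_rec_Fq_neq0 d.+1) /negP.
  by rewrite -rootE.
have wx : w.[x] != 0 by rewrite !hornerE expf_neq0.
have w'x : w^`().[x] != 0 by rewrite deriv_w !hornerE expf_neq0.
have bn k : (0 < k < d.+1)%N -> b k != 0.
  by move=> kd; rewrite mulf_neq0 ?invr_eq0 ?expf_neq0 // subr_eq0 tn.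
have : (wronskian d).[x] != 0.
  have : forall k, (k <= d)%N -> (wronskian k).[x] != 0.
    elim=> [|[|k] IH] ltkd; first by rewrite wronskian0.
      rewrite wronskian1 hornerM hornerC mulf_neq0 // oppr_eq0 mulf_neq0 ?bn //.
      by rewrite invr_eq0 expf_neq0.
    have bk : b k.+2 != 0 by rewrite bn.
    have wqx : (w ^+ (q ^ k.+1)).[x] != 0 by rewrite horner_exp expf_neq0.
    rewrite wronskianS !hornerM hornerC (mulf_neq0 (mulf_neq0 bk wqx)) //.
    by rewrite IH // ltnW.
  by apply.
rewrite /wronskian hornerD hornerN !hornerM (eqP rx) mul0r subr0 mulf_eq0.
by case/norP.
Qed.

End LegendreRecurrence.

(** * The coefficients of psi_p *)

Section TwistedCoef.

Variables (F : finFieldType) (K : fieldType) (gamma : {rmorphism {poly F} -> K}).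
Local Notation q := #|F|%N.
Local Notation Ktau := (twisted gamma).

Lemma coef_tmul_low_r (h f : Ktau) k :
  (forall j, (j < k)%N -> f`_j = 0) -> (h * f : Ktau)`_k = h`_0 * f`_k.
Proof.
move=> f0; rewrite coef_tmul big_ord_recl subn0 expn0 expr1 big1 ?addr0 // => j _.
by rewrite f0 ?frob0 ?mulr0 //= subnS prednK ?leq_subr // subn_gt0.
Qed.

Lemma coef_tmul_low_l (h f : Ktau) k :
  (forall j, (j < k)%N -> f`_j = 0) -> (f * h : Ktau)`_k = f`_k * h`_0 ^+ (q ^ k).
Proof.
move=> f0; rewrite coef_tmul big_ord_recr /= subnn big1 ?add0r // => j _.
by rewrite f0 ?mul0r.
Qed.

End TwistedCoef.

Section HasseInvariant.

Variables (F : finFieldType) (K : fieldType) (gamma : {rmorphism {poly F} -> K}).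
Variables Delta g : K.
Local Notation q := #|F|%N.
Local Notation Ktau := (twisted gamma).
Local Notation t := (gamma 'X).
Local Notation psiT := (drinfeldT gamma Delta g).
Local Notation psi := (drinfeld gamma Delta g).

Lemma coef_drinfeldT k :
  psiT`_k = if k is k'.+1 then
              if k' is k''.+1 then (if k'' is _.+1 then 0 else Delta) else g
            else t.
Proof.
rewrite /drinfeldT !coefD !coef_tconstM expr2 coef_tauM !coefX coefC.
have q0 : (q == 0)%N = false by have := cardF_gt1 F; case: (q).
case: k => [|[|[|k]]] /=; rewrite ?coefX ?expr0n ?expr1n ?q0 /=.
- by rewrite !mulr0 !add0r.
- by rewrite mulr0 mulr1 add0r addr0.
- by rewrite mulr1 mulr0 !addr0.
- by rewrite !mulr0 !addr0.
Qed.

Lemma coef0_mulT (f : Ktau) : (f * psiT : Ktau)`_0 = f`_0 * t.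
Proof. by rewrite coef_tmul big_ord1 coef_drinfeldT expn0 expr1. Qed.

Lemma coef1_mulT (f : Ktau) :
  (f * psiT : Ktau)`_1 = f`_0 * g + f`_1 * t ^+ q.
Proof.
by rewrite coef_tmul !big_ord_recr big_ord0 /= add0r !coef_drinfeldT expn1 expr1.
Qed.

Lemma coefS_mulT (f : Ktau) k :
  (f * psiT : Ktau)`_k.+2 = f`_k * Delta ^+ (q ^ k) + f`_k.+1 * g ^+ (q ^ k.+1)
                            + f`_k.+2 * t ^+ (q ^ k.+2).
Proof.
rewrite coef_tmul !big_ord_recr /= big1 => [|i _].
  by rewrite add0r subnn subSnn -addn2 addKn !coef_drinfeldT; exact: erefl.
rewrite coef_drinfeldT.
have -> : (k.+2 - i)%N = (k - i).-1.+3.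
  by rewrite prednK ?subn_gt0 // -[k.+2]addn2 -addnBAC ?addn2 // ltnW.
by rewrite frob0 mulr0.
Qed.

(** K{tau} is a K[X]-module, where K multiplies on the left and X acts as right
    multiplication by psi_T (the t-motive of psi). This is the action of X - c.
    It makes psi_a the action of the polynomial a on 1, although a has to be
    factored over K, whose elements do not commute with psi_T. *)
Definition twist_sub (c : K) (f : Ktau) : Ktau := f * psiT - tconst gamma c * f.

Lemma twist_subC a b f :
  twist_sub a (twist_sub b f) = twist_sub b (twist_sub a f).
Proof.
rewrite /twist_sub !mulrBl !mulrBr !mulrA -!rmorphM [b * a]mulrC.
rewrite !opprB -!addrA; congr (_ + _).
by rewrite addrCA [RHS]addrCA [- _ - _]addrC.
Qed.

Fixpoint twist_prod k (f : Ktau) : Ktau :=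
  if k is k'.+1 then twist_sub (t ^+ (q ^ k)) (twist_prod k' f) else f.

Lemma twist_prod_sub k c f :
  twist_prod k (twist_sub c f) = twist_sub c (twist_prod k f).
Proof. by elim: k => //= k ->; rewrite twist_subC. Qed.

(** Gekeler's recursion for the Hasse invariant, normalized as a value of the
    Eisenstein series of weight q^k - 1. *)
Fixpoint hasse k : K :=
  if k is k1.+1 then
    if k1 is k2.+1 then
      g ^+ (q ^ k1) * hasse k1 - (t ^+ (q ^ k1) - t) * Delta ^+ (q ^ k2) * hasse k2
    else g
  else 1.

(** In degree k the operator X - t^(q^k) only sees the coefficients of degrees
    k-1 and k-2, the coefficient of degree k being multiplied by
    t^(q^k) - t^(q^k) = 0. For degree k-1 the remaining product has the right
    length; for degree k-2 it has one factor too many, X - t^(q^(k-1)), which can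
    be applied first and multiplies the constant coefficient by t - t^(q^(k-1)).
    That is the recursion of [hasse]. *)
Lemma coef_twist_prod k f : (twist_prod k f)`_k = hasse k * f`_0.
Proof.
suff H : (forall f, (twist_prod k f)`_k = hasse k * f`_0) /\
         (forall f, (twist_prod k.+1 f)`_k.+1 = hasse k.+1 * f`_0) by case: H.
elim: k {f} => [|k [IH0 IH1]]; split=> f.
- by rewrite /= mul1r.
- by rewrite /= expn1 /twist_sub coefB coef1_mulT coef_tconstM; ring.
- exact: IH1.
have lowE : (twist_prod k.+1 f)`_k = hasse k * (f`_0 * t - t ^+ (q ^ k.+1) * f`_0).
  by rewrite [twist_prod _ _]/= -twist_prod_sub IH0 /twist_sub coefB coef0_mulT
             coef_tconstM.
have -> : twist_prod k.+2 f = twist_sub (t ^+ (q ^ k.+2)) (twist_prod k.+1 f) by [].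
have -> : hasse k.+2 = g ^+ (q ^ k.+1) * hasse k.+1
                       - (t ^+ (q ^ k.+1) - t) * Delta ^+ (q ^ k) * hasse k by [].
rewrite {1}/twist_sub coefB coefS_mulT coef_tconstM IH1 lowE.
by move: (twist_prod _ _)`_k.+2 (hasse k.+1) (hasse k) => x y z; ring.
Qed.

Definition left_eval (P : {poly K}) : Ktau := (map_poly (tconst gamma) P).[psiT].

Lemma left_eval_mulXsub P c : left_eval (P * ('X - c%:P)) = twist_sub c (left_eval P).
Proof.
rewrite /left_eval mulrBr [P * c%:P]mulrC rmorphB !rmorphM /= map_polyX map_polyC.
by rewrite hornerD hornerN hornerMX hornerCM.
Qed.

Lemma left_eval_prod k :
  left_eval (\prod_(i < k) ('X - (t ^+ (q ^ i.+1))%:P)) = twist_prod k 1.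
Proof.
elim: k => [|k IH]; first by rewrite big_ord0 /left_eval rmorph1 hornerC.
by rewrite big_ord_recr left_eval_mulXsub IH.
Qed.

Lemma drinfeld_left_eval a : psi a = left_eval (map_poly (gamma \o polyC) a).
Proof. by rewrite /left_eval -map_poly_comp. Qed.

Lemma drinfeld_X : psi 'X = psiT.
Proof. by rewrite /drinfeld /= horner_morphX. Qed.

Lemma coef_twist_prod_deg k : Delta != 0 ->
  (twist_prod k 1)`_k.*2 != 0 /\
  forall j, (k.*2 < j)%N -> (twist_prod k 1)`_j = 0.
Proof.
move=> D0; elim: k => [|k [IH0 IH1]].
  split; first by rewrite /= coefC oner_neq0.
  by case=> // j _; rewrite /= coefC.
rewrite [twist_prod k.+1 1]/= /twist_sub doubleS; split.
  rewrite coefB coefS_mulT coef_tconstM !(IH1 _.+1) ?(IH1 _.+2) ?ltnS //.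
  by rewrite !mul0r mulr0 !addr0 subr0 mulf_neq0 // expf_neq0.
case=> [|[|j]] // ltkj; rewrite coefB coefS_mulT coef_tconstM !IH1 //.
- by rewrite !mul0r mulr0 !addr0 subr0.
- by rewrite ltnW // ltnW.
- exact: ltnW.
Qed.

(** Comparing the lowest terms of f psi_T and psi_T f shows that if f commutes
    with psi_T and tau^k is its lowest term, then t is fixed by the k-th power of
    Frobenius. *)
Lemma commute_low_coef (f : Ktau) k : f * psiT = psiT * f ->
  (forall j, (j < k)%N -> f`_j = 0) -> t ^+ (q ^ k) != t -> f`_k = 0.
Proof.
move=> comm f0 tk; have := congr1 (fun h : Ktau => h`_k) comm.
rewrite coef_tmul_low_l // coef_tmul_low_r // coef_drinfeldT => /eqP.
rewrite mulrC -subr_eq0 -mulrBl mulf_eq0 subr_eq0 (negPf tk) /=.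
by move/eqP.
Qed.

Variable p : {poly F}.
Hypothesis p_irr : irreducible_poly p.
Hypothesis ker_gamma : forall a : {poly F}, gamma a = 0 <-> p %| a.
Local Notation d := (size p).-1.
Local Notation lc := (gamma (lead_coef p)%:P).

Lemma drinfeld_p : psi p = tconst gamma lc * twist_prod d 1.
Proof.
rewrite drinfeld_left_eval (gamma_p_factor p_irr ker_gamma) -left_eval_prod.
by rewrite /left_eval -mul_polyC rmorphM /= map_polyC hornerCM.
Qed.

Lemma lc_neq0 : lc != 0.
Proof.
by rewrite (fmorph_eq0 (gamma \o polyC)) lead_coef_eq0 (irr_neq0 p_irr).
Qed.

Lemma coef_p_hasse : (psi p)`_d = lc * hasse d.
Proof. by rewrite drinfeld_p coef_tconstM coef_twist_prod coefC mulr1. Qed.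

Lemma psi_p_comm : psi p * psiT = psiT * psi p.
Proof. by rewrite -drinfeld_X -!rmorphM mulrC. Qed.

Lemma deg_gt0 : (0 < d)%N.
Proof. by rewrite -ltnS prednK ?p_irr.1 // ltnW // p_irr.1. Qed.

(** The lowest term of psi_p is not constant, as gamma kills p, and its degree is
    the exponent of a power of Frobenius that fixes t, by [commute_low_coef]. *)
Lemma coef_p_low k : (k < d)%N -> (psi p)`_k = 0.
Proof.
have [n le_kn] := ubnP k; elim: n k le_kn => // n IH k lekn ltkd.
case: k => [|k] in lekn ltkd *.
  rewrite drinfeld_p coef_tconstM; case E: d ltkd => [|m] // _.
  rewrite /= /twist_sub coefB coef0_mulT coef_tconstM -E.
  by rewrite (frob_T_deg p_irr ker_gamma) [_ * t]mulrC subrr mulr0.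
apply: commute_low_coef; first exact: psi_p_comm.
  by move=> j ltj; apply: IH; [apply: leq_trans ltj _ | apply: ltn_trans ltkd].
exact: (frob_T_neq p_irr ker_gamma).
Qed.

Lemma size_drinfeld_p : Delta != 0 -> size (psi p) = d.*2.+1.
Proof.
move=> D0; have [top0 hi0] := coef_twist_prod_deg d D0.
apply/eqP; rewrite eqn_leq; apply/andP; split.
  by apply/leq_sizeP => j hj; rewrite drinfeld_p coef_tconstM hi0 ?mulr0.
rewrite ltnNge; apply/negP => /leq_sizeP/(_ _ (leqnn _))/eqP.
by rewrite drinfeld_p coef_tconstM mulf_eq0 (negPf lc_neq0) (negPf top0).
Qed.

(** The degree of the lowest term of psi_p is a multiple of d, so it is 2d as
    soon as it is not d. *)
Lemma coef_p_mid k : (psi p)`_d = 0 -> (k < d.*2)%N -> (psi p)`_k = 0.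
Proof.
move=> pd0; have [n le_kn] := ubnP k; elim: n k le_kn => // n IH k lekn ltkd.
have [ltk|] := ltnP k d; first exact: coef_p_low.
rewrite leq_eqVlt => /predU1P[<-//|ltdk].
apply: commute_low_coef; first exact: psi_p_comm.
  move=> j ltj; apply: IH; last exact: ltn_trans ltkd.
  exact: leq_trans ltj _.
have -> : t ^+ (q ^ k) = t ^+ (q ^ (k - d)).
  rewrite -{1}(subnKC (ltnW ltdk)) -frob_comp.
  by rewrite (frob_T_deg p_irr ker_gamma).
apply: (frob_T_neq p_irr ker_gamma); rewrite subn_gt0 ltdk.
by rewrite ltn_subLR ?addnn // ltnW.
Qed.

End HasseInvariant.

(** * The zeros of a twisted polynomial *)

Section Torsion.

Variables (F : finFieldType) (K : closedFieldType).
Variable gamma : {rmorphism {poly F} -> K}.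
Local Notation q := #|F|%N.
Local Notation Ktau := (twisted gamma).

Lemma monomial_of_roots0 (h : {poly K}) :
  (forall x, root h x -> x = 0) -> h = lead_coef h *: 'X^((size h).-1).
Proof.
move=> h0; have [rs hE] := closed_field_poly_normal h.
have [->|hn] := eqVneq h 0; first by rewrite lead_coef0 scale0r.
have lch : lead_coef h != 0 by rewrite lead_coef_eq0.
have rsE : rs = nseq (size rs) 0.
  apply/all_pred1P/allP => x xrs /=; apply/eqP/h0.
  by rewrite hE rootZ // root_prod_XsubC.
have hX : h = lead_coef h *: 'X^(size rs).
  rewrite {1}hE rsE size_nseq; congr (_ *: _).
  by rewrite big_nseq subr0 iter_mulr_1.
by rewrite {3}hX size_scale // size_polyXn.
Qed.

Definition tact_poly (f : Ktau) : {poly K} := \sum_(k < size f) f`_k *: 'X^(q ^ k).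

Lemma horner_tact_poly f x : (tact_poly f).[x] = tact f x.
Proof.
rewrite horner_sum; apply: eq_bigr => k _.
by rewrite hornerZ hornerXn.
Qed.

Lemma coef_tact_poly f k : (tact_poly f)`_(q ^ k) = f`_k.
Proof.
rewrite coef_sum; under eq_bigr do rewrite coefZ coefXn eqn_exp2l ?cardF_gt1 //.
have [ltk|lek] := ltnP k (size f).
  rewrite (bigD1 (Ordinal ltk)) //= eqxx mulr1 big1 ?addr0 // => j.
  by rewrite -val_eqE /= eq_sym => /negPf ->; rewrite mulr0.
rewrite nth_default // big1 // => j _; case: eqP => [e|]; last by rewrite mulr0.
by move: (ltn_ord j); rewrite -e ltnNge lek.
Qed.

Lemma size_tact_poly (f : Ktau) : f != 0 ->
  size (tact_poly f) = (q ^ (size f).-1).+1.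
Proof.
move=> f0; apply/eqP; rewrite eqn_leq; apply/andP; split.
  apply: (leq_trans (size_sum _ _ _)); apply/bigmax_leqP => k _.
  rewrite (leq_trans (size_scale_leq _ _)) // size_polyXn ltnS.
  rewrite leq_exp2l ?cardF_gt1 // -ltnS prednK ?ltn_ord // size_poly_gt0.
  exact: f0.
rewrite ltnNge; apply/negP => /leq_sizeP/(_ _ (leqnn _))/eqP.
by rewrite coef_tact_poly -lead_coefE lead_coef_eq0 (negPf f0).
Qed.

(** Over an algebraically closed field a polynomial whose only root is 0 is a
    monomial, and the coefficients of f are those of the additive polynomial
    [tact_poly f] at the exponents q^k. *)
Lemma tact_ker0P (f : Ktau) : f != 0 ->
  (forall x, tact f x = 0 -> x = 0) <->
  (forall k, (k < (size f).-1)%N -> f`_k = 0).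
Proof.
move=> f0; split=> [inj k ltk | low x].
  have -> : f`_k = (tact_poly f)`_(q ^ k) by rewrite coef_tact_poly.
  rewrite (@monomial_of_roots0 (tact_poly f)) => [|x]; last first.
    by rewrite rootE horner_tact_poly => /eqP/inj.
  rewrite coefZ coefXn size_tact_poly //= eqn_exp2l ?cardF_gt1 //.
  by rewrite ltn_eqF // mulr0.
have sz : (0 < size f)%N by rewrite size_poly_gt0 f0.
rewrite /tact; case E: (size f) sz low => [|m] // _ low.
rewrite big_ord_recr /= big1 => [|k _]; last by rewrite low ?mul0r.
rewrite add0r => /eqP; rewrite mulf_eq0 expf_eq0 card_expn_gt0 /=.
have : f`_m != 0 by rewrite -[m]/(m.+1.-1) -E -lead_coefE lead_coef_eq0.
by move=> /negPf -> /eqP.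
Qed.

End Torsion.

(** * The isogeny tau - 1 *)

Section Isogeny.

Variables (F : finFieldType) (K : fieldType) (gamma : {rmorphism {poly F} -> K}).
Variable Delta : K.
Local Notation q := #|F|%N.
Local Notation Ktau := (twisted gamma).
Local Notation t := (gamma 'X).
Local Notation psi := (drinfeld gamma Delta (- (Delta + t))).
Local Notation phi := (drinfeld gamma (Delta ^+ q) (- (Delta + t ^+ q))).

Definition tau_sub1 : Ktau := tau gamma - 1.

(** In a Legendre form 1 is a T-torsion point, so tau - 1, whose kernel is F_q,
    is a right factor of psi_T. Exchanging the two factors gives the
    isogenous module phi. *)
Lemma drinfeldT_factor_r :
  drinfeldT gamma Delta (- (Delta + t)) =
  (tconst gamma Delta * tau gamma - tconst gamma t) * tau_sub1.
Proof.
rewrite /drinfeldT /tau_sub1 rmorphN rmorphD mulNr mulrDl opprD.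
rewrite mulrBr !mulrBl !mulr1 opprB expr2 mulrA -!addrA; congr (_ + _).
by rewrite addrCA [- _ + tconst _ _]addrC.
Qed.

Lemma drinfeldT_factor_l :
  drinfeldT gamma (Delta ^+ q) (- (Delta + t ^+ q)) =
  tau_sub1 * (tconst gamma Delta * tau gamma - tconst gamma t).
Proof.
rewrite /drinfeldT /tau_sub1 rmorphN rmorphD mulNr mulrDl opprD.
rewrite mulrBl !mulrBr !mul1r [tau gamma * (_ * _)]mulrA !tau_tconst opprB.
rewrite -[in RHS]mulrA -expr2 -!addrA; congr (_ + _).
by rewrite addrCA [- _ + tconst _ _]addrC.
Qed.

Lemma isogeny_intertwine a : tau_sub1 * psi a = phi a * tau_sub1.
Proof.
elim/poly_ind: a => [|a c IH]; first by rewrite !rmorph0 mulr0 mul0r.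
rewrite !rmorphD !rmorphM [LHS]mulrDr [RHS]mulrDl !drinfeld_X; congr (_ + _).
  rewrite mulrA IH -!mulrA; congr (_ * _).
  by rewrite drinfeldT_factor_l drinfeldT_factor_r mulrA.
rewrite /drinfeld /= !horner_morphC /= /tau_sub1 mulrBl mulrBr mul1r mulr1.
by rewrite tau_tconst -[q]expn1 frob_gammaC.
Qed.

Variable p : {poly F}.
Hypothesis p_irr : irreducible_poly p.
Hypothesis ker_gamma : forall a : {poly F}, gamma a = 0 <-> p %| a.
Local Notation d := (size p).-1.

(** Both sides of the intertwining relation start in degree d, where the
    constant term -1 of tau - 1 acts by a sign on either side. *)
Lemma isogeny_coef : (psi p)`_d = (phi p)`_d.
Proof.
have := congr1 (fun f : Ktau => f`_d) (isogeny_intertwine p).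
rewrite coef_tmul_low_r; last exact: coef_p_low.
rewrite coef_tmul_low_l; last exact: coef_p_low.
have -> : tau_sub1`_0 = -1 by rewrite /tau_sub1 coefB coefX coefC sub0r.
by rewrite (frobN gamma) expr1n mulN1r mulrN1 => /oppr_inj.
Qed.

End Isogeny.

(** * Hasse invariants of Legendre forms *)

Section Legendre.

Variables (F : finFieldType) (K : fieldType) (gamma : {rmorphism {poly F} -> K}).
Local Notation q := #|F|%N.
Local Notation t := (gamma 'X).
Hypothesis t_neq0 : t != 0.

Variables (lambda : K).
Local Notation w := ((lambda ^+ q - lambda) ^+ q.-1).
Local Notation c := ((t ^+ q.-1)^-1).
Hypothesis w_neq0 : w != 0.

Variable u : nat -> K.
Hypothesis u0 : u 0 = 1.
Hypothesis u1 : u 1 = w + c.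
Hypothesis uS : forall i, u i.+2 =
  (w + c) ^+ (q ^ i.+1) * u i.+1
  - (t ^+ (q ^ i.+1) - t) / t ^+ (q ^ i.+2) * w ^+ (q ^ i) * u i.

(** The Hasse recursion of phi, not that of psi, is the recursion of the U_i up
    to scaling: with eps = - t^q / w the coefficient of tau in phi_T is
    eps (w + t^(1-q)), and the scaling that removes the powers of eps turns
    the powers of Delta^q into those of w / t^(q^2). *)
Lemma hasse_legendre k :
  hasse gamma (legendreDelta gamma lambda ^+ q)
    (- (legendreDelta gamma lambda + t ^+ q)) k =
  (\prod_(i < k) (- (t ^+ q / w)) ^+ (q ^ i)) * u k.
Proof.
rewrite /legendreDelta; set D := t / w; set eps := - (t ^+ q / w).
set g := - _; have tq : t ^+ q = t * t ^+ q.-1.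
  by rewrite -exprS prednK // (ltnW (cardF_gt1 F)).
have gE : g = eps * (w + c).
  rewrite /g /eps /D tq; have : t ^+ q.-1 != 0 by rewrite expf_neq0.
  by move: (t ^+ _) w w_neq0 => x y y0 x0; field; rewrite x0 y0.
have DE k' : (D ^+ q) ^+ (q ^ k') = eps ^+ (q ^ k') * eps ^+ (q ^ k'.+1)
                                     * w ^+ (q ^ k') / t ^+ (q ^ k'.+2).
  have -> : D ^+ q = eps * eps ^+ q * w / t ^+ (q ^ 2).
    have -> : eps ^+ q = - (t ^+ (q ^ 2) / w ^+ q).
      have := frobN gamma 1 (t ^+ q / w).
      by rewrite expn1 expr_div_n -[t ^+ q ^+ q]exprM mulnn.
    rewrite /D /eps expr_div_n.
    have : t ^+ (q ^ 2) != 0 by rewrite expf_neq0.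
    have : w ^+ q != 0 by rewrite expf_neq0.
    move: (t ^+ (q ^ 2)) (w ^+ q) w (t ^+ q) w_neq0 => x y z r z0 y0 x0.
    by field; rewrite x0 y0 z0.
  by rewrite !exprMn exprVn -!exprM -!expnS -expnD add2n.
suff H : hasse gamma (D ^+ q) g k = (\prod_(i < k) eps ^+ (q ^ i)) * u k /\
  hasse gamma (D ^+ q) g k.+1 = (\prod_(i < k.+1) eps ^+ (q ^ i)) * u k.+1.
  by case: H.
elim: k => [|k [IH0 IH1]].
  by rewrite big_ord0 big_ord1 expn0 expr1 u0 u1 mulr1.
split=> //.
have -> : hasse gamma (D ^+ q) g k.+2 = g ^+ (q ^ k.+1) * hasse gamma (D ^+ q) g k.+1
  - (t ^+ (q ^ k.+1) - t) * (D ^+ q) ^+ (q ^ k) * hasse gamma (D ^+ q) g k by [].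
rewrite IH0 IH1 DE gE exprMn uS !big_ord_recr /=.
by ring.
Qed.

End Legendre.

(** * The Deuring polynomial *)

Section Deuring.

Variables (F : finFieldType) (K : closedFieldType).
Variable gamma : {rmorphism {poly F} -> K}.
Variable p : {poly F}.
Hypothesis p_irr : irreducible_poly p.
Hypothesis ker_gamma : forall a : {poly F}, gamma a = 0 <-> p %| a.
Hypothesis p_neT : ~~ (p %= 'X).
Local Notation q := #|F|%N.
Local Notation t := (gamma 'X).
Local Notation d := (size p).-1.
Local Notation U := (legendreU_mod gamma p).

Let t_neq0 : t != 0 := gammaX_neq0 p_irr ker_gamma p_neT.
Let U0 : U 0 = 1 := legendreU_mod0 p_irr ker_gamma p_neT.
Let U1 := legendreU_mod1 p_irr ker_gamma p_neT.
Let US := legendreU_modS p_irr ker_gamma p_neT.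

(** By [coef_p_low] and [coef_p_mid] psi_p is a monomial if and only if its
    coefficient of degree d vanishes. *)
Lemma supersingularP Delta g : Delta != 0 ->
  supersingular p (drinfeld gamma Delta g) <-> (drinfeld gamma Delta g p)`_d = 0.
Proof.
move=> D0; have szp := size_drinfeld_p g p_irr ker_gamma D0.
have psi0 : drinfeld gamma Delta g p != 0.
  by rewrite -size_poly_gt0 szp.
have tact0 : tact (drinfeld gamma Delta g p) 0 = 0.
  by rewrite /tact big1 // => k _; rewrite frob0 mulr0.
have [ker_coef coef_ker] := tact_ker0P psi0.
rewrite szp /= in ker_coef coef_ker.
have ltd : (d < d.*2)%N by rewrite -addnn -[ltnLHS]addn0 ltn_add2l (deg_gt0 p_irr).
split=> [ss | cd0].
  apply: ker_coef => // x x0.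
  by have : torsion (drinfeld gamma Delta g) p x by []; rewrite ss.
apply/seteqP; split=> [x /= x0|x ->] //.
by apply: coef_ker x0 => k ltk; apply: coef_p_mid.
Qed.

Lemma supersingular_locusP lambda :
  supersingular_locus gamma p lambda <-> root (U d) lambda.
Proof.
have [Fq | nFq] := pselect (inFq gamma lambda); last first.
- have D0 := legendreDelta_neq0 t_neq0 nFq.
  have w0 : (lambda ^+ q - lambda) ^+ q.-1 != 0.
    by apply: contraNneq D0; rewrite /legendreDelta => ->; rewrite invr0 mulr0.
  have -> : supersingular_locus gamma p lambda <->
            supersingular p (legendre gamma lambda) by split=> [[]|].
  apply: (iff_trans (supersingularP _ D0)).
  rewrite (isogeny_coef _ p_irr ker_gamma) (coef_p_hasse _ _ p_irr ker_gamma).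
  rewrite (@hasse_legendre _ _ gamma t_neq0 lambda w0 (fun i => (U i).[lambda])).
  + rewrite rootE; split=> [/eqP|/eqP ->]; last by rewrite !mulr0.
    have scale_neq0 : \prod_(i < d)
        (- (t ^+ q / (lambda ^+ q - lambda) ^+ q.-1)) ^+ (q ^ i) != 0.
      apply/prodf_neq0 => i _.
      by rewrite expf_neq0 // oppr_eq0 mulf_neq0 ?invr_eq0 // expf_neq0.
    by rewrite !mulf_eq0 (negPf (lc_neq0 gamma p_irr)) (negPf scale_neq0).
  + by rewrite U0 hornerC.
  + by rewrite U1 !hornerE.
  + by move=> i; rewrite US !hornerE.
- split=> [[]//|]; case: Fq => c0 ->.
  rewrite rootE (negPf (legendre_rec_Fq_neq0 t_neq0 U0 U1 US _ _)) //.
  by rewrite -[q]expn1 frob_gammaC.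
Qed.

Lemma deuring_legendreU :
  finite_set (supersingular_locus gamma p) /\ deuring gamma p = U d.
Proof.
have mU : U d \is monic := legendre_rec_monic U0 U1 US d.
have [rs UE] := closed_field_poly_normal (U d).
rewrite (monicP mU) scale1r in UE.
have urs : uniq rs.
  rewrite -separable_prod_XsubC -UE unlock; apply: Pdiv.ClosedField.root_coprimep => x.
  apply: (legendre_rec_simple_roots gamma t_neq0 U0 U1 US) => i ltid.
  exact: (frob_T_neq p_irr ker_gamma).
have locusE : supersingular_locus gamma p = [set` rs]%classic.
  apply/seteqP; split=> x; rewrite /= -root_prod_XsubC -UE => H.
    exact/supersingular_locusP.
  exact/supersingular_locusP.
by rewrite /deuring locusE; split; [exact: finite_seq | rewrite -fsbig_seq].
Qed.

End Deuring.

Theorem theorem1 (F : finFieldType) (L : fieldType)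
    (gamma : {rmorphism {poly F} -> L})
    (Lbar : closedFieldType) (iota : {rmorphism L -> Lbar})
    (iota_alg : forall x : Lbar, algebraicOver iota x)
    (p : {poly F}) (d : nat)
    (p_irr : irreducible_poly p) (p_deg : size p = d.+1)
    (p_neT : ~~ (p %= 'X))
    (ker_gamma : forall a : {poly F}, gamma a = 0 <-> p %| a) :
  finite_set (supersingular_locus (iota \o gamma) p) /\
  deuring (iota \o gamma) p =
    map_poly (residue_embed (iota \o gamma) (p := p))
      (map_poly (reduction p) (legendreU F d)).
Proof.
have ker_comp a : (iota \o gamma) a = 0 <-> p %| a.
  rewrite -ker_gamma /=; split=> [/eqP|->]; last by rewrite rmorph0.
  by rewrite fmorph_eq0 => /eqP.
have := deuring_legendreU p_irr ker_comp p_neT.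
by rewrite /legendreU_mod p_deg.
Qed.
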